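(* Let $M_n=F_n/F_n''$ be the free metabelian group of rank $n\ge 2$ with basis the images $x_1,\dots,x_n$ of the free generators. (i) The group $\mathrm{Aut}\,M_2$ acts transitively on the set of $\Delta$-primitive elements of $M_2$: every $\Delta$-primitive element of $M_2$ is an automorphic image of $[x_1,x_2]$, and in fact has the form $[x_1,x_2]^g$ or $[x_2,x_1]^g$ for some $g\in M_2$. (ii) If $n$ is odd, $M_n$ has no $\Delta$-primitive elements.
   Context: Let $A_n=M_n/M_n'\cong F_n/F_n'$ (free abelian of rank $n$), $\mathbb{Z}A_n$ its integral group ring and $\Delta_A$ its augmentation ideal. For $g\in F_n$, the left Fox derivatives $d_i(g)\in\mathbb{Z}F_n$ are the unique elements with $g-1=\sum_{i=1}^n d_i(g)(x_i-1)$. For $h\in M_n$ the abelianized Fox derivatives $d_i(h)\in\mathbb{Z}A_n$ are the images in $\mathbb{Z}A_n$ of $d_i(\tilde h)$ for any preimage $\tilde h\in F_n$ of $h$ (this does not depend on the choice of preimage). An element $h\in M_n$ is $\Delta$-primitive if $d_1(h),\dots,d_n(h)$ generate $\Delta_A$ as an ideal of $\mathbb{Z}A_n$. $[a,b]=a^{-1}b^{-1}ab$, $a^g=g^{-1}ag$. *)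

(* Defs.v *)
From HB Require Import structures.
From mathcomp Require Import all_boot all_order all_algebra.
From mathcomp Require Import fraction.
From mathcomp Require Import mpoly.

Set Implicit Arguments.
Unset Strict Implicit.
Unset Printing Implicit Defensive.

Import GRing.Theory.
Local Open Scope ring_scope.

(* Words in the free group F_n.  A letter (i, false) is x_i, (i, true) is    *)
(* x_i^{-1}.  A word is a (not necessarily reduced) sequence of letters.     *)
Definition letter (n : nat) : Type := ('I_n * bool)%type.
Definition word (n : nat) : Type := seq (letter n).

Definition gen {n : nat} (i : 'I_n) : word n := [:: (i, false)].
Definition linv {n : nat} (l : letter n) : letter n := (l.1, ~~ l.2).
Definition winv {n : nat} (w : word n) : word n := rev (map linv w).
Definition wmul {n : nat} (u v : word n) : word n := u ++ v.

Definition comm {n : nat} (a b : word n) : word n :=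
  winv a ++ winv b ++ a ++ b.
Definition conj {n : nat} (a g : word n) : word n := winv g ++ a ++ g.

(* The free metabelian group M_n = F_n / F_n'' : two words represent the     *)
(* same element of M_n iff they are related by the smallest congruence on    *)
(* words containing free cancellation and the metabelian law                 *)
(* [[a,b],[c,d]] = 1 (the normal closure of these relators in F_n is F_n''). *)
Inductive meq {n : nat} : word n -> word n -> Prop :=
| meq_refl u : meq u u
| meq_sym u v : meq u v -> meq v u
| meq_trans u v w : meq u v -> meq v w -> meq u w
| meq_cat u u' v v' : meq u u' -> meq v v' -> meq (u ++ v) (u' ++ v')
| meq_cancel (l : letter n) : meq [:: l; linv l] [::]
| meq_metab a b c d : meq (comm (comm a b) (comm c d)) [::].

Definition subst_letter {n : nat} (s : 'I_n -> word n) (l : letter n) : word n :=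
  if l.2 then winv (s l.1) else s l.1.
Definition subst {n : nat} (s : 'I_n -> word n) (w : word n) : word n :=
  flatten (map (subst_letter s) w).

(* s defines an automorphism of M_n: it has a two-sided inverse t          *)
(* (checked on generators, which suffices since M_n is relatively free).    *)
Definition is_aut {n : nat} (s : 'I_n -> word n) : Prop :=
  exists t : 'I_n -> word n,
    forall i : 'I_n, meq (subst s (t i)) (gen i) /\ meq (subst t (s i)) (gen i).

(* The integral group ring Z A_n of A_n = Z^n is the Laurent polynomial ring *)
(* Z[x_1^{+-1},...,x_n^{+-1}], realised as a subring of the fraction field   *)
(* of Z[x_1,...,x_n].                                                        *)
Definition QA (n : nat) := {fraction {mpoly int[n]}}.

Definition toQA {n : nat} (p : {mpoly int[n]}) : QA n := @FracField.tofrac _ p.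

Definition xA {n : nat} (i : 'I_n) : QA n := toQA 'X_i.

Definition monoA (n : nat) : {mpoly int[n]} := \prod_(i < n) 'X_i.

Definition inZA {n : nat} (x : QA n) : Prop :=
  exists (k : nat) (p : {mpoly int[n]}), x = toQA p / toQA (monoA n) ^+ k.

Definition inDelta {n : nat} (x : QA n) : Prop :=
  exists (k : nat) (p : {mpoly int[n]}),
    x = toQA p / toQA (monoA n) ^+ k /\ p.@[fun _ => 1] = 0.

Definition letterA {n : nat} (l : letter n) : QA n :=
  if l.2 then (xA l.1)^-1 else xA l.1.
Definition wordA {n : nat} (w : word n) : QA n := \prod_(l <- w) letterA l.

Definition fox_letter {n : nat} (i : 'I_n) (l : letter n) : QA n :=
  if l.1 == i then (if l.2 then - (xA i)^-1 else 1) else 0.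

Fixpoint fox {n : nat} (i : 'I_n) (w : word n) : QA n :=
  match w with
  | [::] => 0
  | l :: w' => fox_letter i l + letterA l * fox i w'
  end.

(* h is Delta-primitive: d_1(h),...,d_n(h) generate Delta_A as an ideal of  *)
(* Z A_n, i.e. each d_i(h) lies in Delta_A and each generator x_j - 1 of   *)
(* Delta_A is a Z A_n-linear combination of the d_i(h).                     *)
Definition delta_primitive {n : nat} (h : word n) : Prop :=
  (forall i : 'I_n, inDelta (fox i h)) /\
  (forall j : 'I_n, exists c : 'I_n -> QA n,
      (forall i, inZA (c i)) /\ xA j - 1 = \sum_(i < n) c i * fox i h).

(* Main.v *)
(* By the fundamental formula of the Fox calculus, the derivatives of a
   Delta-primitive h have augmentation equal to the exponent sums of h, so h
   lies in M_n' and sum_i d_i(h) (x_i - 1) = 0.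

   For (ii), expand the d_i(h) modulo the square of the augmentation ideal:
   their linear parts form an integer matrix C.  The relation makes C
   antisymmetric, and generation of Delta makes it invertible, so n is even.

   For (i), every element of M_2' is a product of conjugates of
   c = [x_1,x_2]^{+-1}, which gives d_i(h) = u d_i(c) with u in ZA_2.  If h is
   Delta-primitive then u divides both x_1 - 1 and x_2 - 1, hence is
   +-monomial; linear independence of monomials, applied to the exponents of
   the conjugating elements, then shows that h is a single conjugate of
   c^{+-1}.  Conversely, for an automorphism s of M_2, the chain rule makes the
   Jacobian determinant a unit J of ZA_2, and d_i(s(c)) is d_i(c) times J and a
   monomial. *)

Require Import Defs.
From HB Require Import structures.
From mathcomp Require Import all_boot all_order all_algebra.
From mathcomp Require Import fraction.
From mathcomp Require Import mpoly ring zify.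

Set Implicit Arguments.
Unset Strict Implicit.
Unset Printing Implicit Defensive.

Import Order.TTheory GRing.Theory Num.Theory.
Local Open Scope ring_scope.

(** * Embedding of the polynomial ring in its fraction field *)

HB.instance Definition _ n := GRing.isZmodMorphism.Build _ _ (@toQA n)
  (@tofrac_is_zmod_morphism _).
HB.instance Definition _ n := GRing.isMonoidMorphism.Build _ _ (@toQA n)
  (@tofrac_is_monoid_morphism _).

Lemma toQA_inj n : injective (@toQA n).
Proof. by move=> p q e; apply/eqP; rewrite -tofrac_eq; apply/eqP. Qed.

Lemma monoA_neq0 n : monoA n != 0.
Proof.
apply/prodf_neq0 => i _; apply/eqP => /(congr1 (mcoeff U_(i)%MM)).
by rewrite mcoeff0 mcoeffXU eqxx.
Qed.

Lemma toQA_monoA_neq0 n k : toQA (monoA n) ^+ k != 0.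
Proof. by rewrite expf_neq0 // tofrac_eq0 monoA_neq0. Qed.

Lemma xA_neq0 n (i : 'I_n) : xA i != 0.
Proof.
rewrite tofrac_eq0; apply/eqP => /(congr1 (mcoeff U_(i)%MM)).
by rewrite mcoeff0 mcoeffXU eqxx.
Qed.

Lemma meval_monoA n : (monoA n).@[fun _ => 1] = 1.
Proof. by rewrite rmorph_prod big1 //= => i _; rewrite mevalXU. Qed.

Lemma meval_monoAX n k : (monoA n ^+ k).@[fun _ => 1] = 1.
Proof. by rewrite rmorphXn /= meval_monoA expr1n. Qed.

(** * The Laurent polynomial ring *)

Section Laurent.
Context {n : nat}.
Implicit Types (p q : {mpoly int[n]}) (x y : QA n) (i : 'I_n).

Definition laurent (k : nat) (p : {mpoly int[n]}) : QA n :=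
  toQA p / toQA (monoA n) ^+ k.

Lemma laurentMX k j p : laurent (k + j) (p * monoA n ^+ j) = laurent k p.
Proof.
rewrite /laurent rmorphM rmorphXn /= exprD -mulf_div divff ?mulr1 //.
exact: toQA_monoA_neq0.
Qed.

Lemma laurent_inj k : injective (laurent k).
Proof.
move=> p q /(congr1 (fun x => x * toQA (monoA n) ^+ k)).
by rewrite !divfK ?toQA_monoA_neq0 // => /toQA_inj.
Qed.

Lemma laurent_sum (I : Type) (r : seq I) (P : pred I) (F : I -> {mpoly int[n]}) k :
  laurent k (\sum_(i <- r | P i) F i) = \sum_(i <- r | P i) laurent k (F i).
Proof. by rewrite /laurent raddf_sum mulr_suml. Qed.

Lemma laurentM k j p q : laurent k p * laurent j q = laurent (k + j) (p * q).
Proof. by rewrite /laurent mulf_div -exprD rmorphM. Qed.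

Lemma laurent0 p : laurent 0 p = toQA p.
Proof. by rewrite /laurent expr0 divr1. Qed.

(* [evalA x z]: the augmentation of [x] is [z]. *)
Definition evalA x (z : int) : Prop :=
  exists k p, x = laurent k p /\ p.@[fun _ => 1] = z.

(** Over a common denominator the two numerators agree, and [monoA n] takes the value 1 at the point
    with all coordinates 1. *)
Lemma evalA_inj x z t : evalA x z -> evalA x t -> z = t.
Proof.
move=> [k [p [-> <-]]] [j [q [e <-]]].
have : laurent (k + j) (p * monoA n ^+ j) = laurent (k + j) (q * monoA n ^+ k).
  by rewrite laurentMX [(k + j)%N]addnC laurentMX.
move=> /laurent_inj /(congr1 (meval (fun _ => 1))).
by rewrite !rmorphM /= !meval_monoAX !mulr1.
Qed.

Lemma evalAD x y z t : evalA x z -> evalA y t -> evalA (x + y) (z + t).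
Proof.
move=> [k [p [-> <-]]] [j [q [-> <-]]].
exists (k + j)%N, (p * monoA n ^+ j + q * monoA n ^+ k); split; last first.
  by rewrite rmorphD !rmorphM /= !meval_monoAX !mulr1.
rewrite /laurent rmorphD mulrDl -!/(laurent _ _) laurentMX.
by rewrite [(k + j)%N]addnC laurentMX.
Qed.

Lemma evalAM x y z t : evalA x z -> evalA y t -> evalA (x * y) (z * t).
Proof.
move=> [k [p [-> <-]]] [j [q [-> <-]]].
by exists (k + j)%N, (p * q); rewrite laurentM rmorphM.
Qed.

Lemma evalA_toQA p : evalA (toQA p) p.@[fun _ => 1].
Proof. by exists 0, p; rewrite laurent0. Qed.

Lemma evalAZ (z : int) : evalA (z%:~R) z.
Proof. by exists 0, z%:~R; rewrite laurent0 !rmorph_int intz. Qed.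

Lemma evalAN x z : evalA x z -> evalA (- x) (- z).
Proof. by move/(evalAM (evalAZ (-1))); rewrite rmorphN1 !mulN1r. Qed.

Lemma evalA_xA i : evalA (xA i) 1.
Proof. by have := evalA_toQA 'X_i; rewrite mevalXU. Qed.

Lemma evalA_xAV i : evalA (xA i)^-1 1.
Proof.
(* Over the denominator [monoA n], the numerator of the inverse of [x_i] is the product of the other
   variables. *)
exists 1%N, (\prod_(j < n | j != i) 'X_j); split.
  rewrite /laurent expr1 /monoA [in X in _ / X](bigD1 i) //= rmorphM /=.
  rewrite invfM mulrCA divff ?mulr1 //.
  rewrite rmorph_prod; apply/prodf_neq0 => j _; exact: xA_neq0.
by rewrite rmorph_prod big1 //= => j _; rewrite mevalXU.
Qed.

Lemma inZA_evalA x : inZA x <-> exists z, evalA x z.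
Proof.
split=> [[k [p ->]]|[z [k [p [-> _]]]]]; last by exists k, p.
by exists p.@[fun _ => 1], k, p.
Qed.

Lemma inDelta_evalA x : inDelta x <-> evalA x 0.
Proof. by split=> [[k [p [-> h]]]|[k [p [-> h]]]]; exists k, p. Qed.

Lemma inZAD x y : inZA x -> inZA y -> inZA (x + y).
Proof.
move=> /inZA_evalA[z hz] /inZA_evalA[t ht]; apply/inZA_evalA.
by exists (z + t); apply: evalAD.
Qed.

Lemma inZAM x y : inZA x -> inZA y -> inZA (x * y).
Proof.
move=> /inZA_evalA[z hz] /inZA_evalA[t ht]; apply/inZA_evalA.
by exists (z * t); apply: evalAM.
Qed.

Lemma inZAN x : inZA x -> inZA (- x).
Proof.
by move=> /inZA_evalA[z hz]; apply/inZA_evalA; exists (- z); apply: evalAN.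
Qed.

Lemma inZA_int (z : int) : @inZA n z%:~R.
Proof. by apply/inZA_evalA; exists z; apply: evalAZ. Qed.

Lemma inZA0 : @inZA n 0. Proof. exact: (inZA_int 0). Qed.
Lemma inZA1 : @inZA n 1. Proof. exact: (inZA_int 1). Qed.

Lemma inZA_sum (I : Type) (r : seq I) (P : pred I) (F : I -> QA n) :
  (forall j, P j -> inZA (F j)) -> inZA (\sum_(i <- r | P i) F i).
Proof. by move=> h; apply: big_ind => //; [exact: inZA0 | exact: inZAD]. Qed.

(** Allows relations between Fox derivatives to be read as polynomial identities between
    numerators. *)
Lemma inZA_common (I : finType) (x : I -> QA n) :
  (forall j, inZA (x j)) ->
  exists k (p : I -> {mpoly int[n]}), forall j, x j = laurent k (p j).
Proof.
move=> /fin_all_exists[k] /fin_all_exists[p h].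
exists (\max_l k l), (fun j => p j * monoA n ^+ (\max_l k l - k j)) => j.
by rewrite h -/(laurent _ _) -(laurentMX _ (\max_l k l - k j)) subnKC ?leq_bigmax.
Qed.

End Laurent.

(** * Fox derivatives of words *)

(* Over an abstract field, because [field] unfolds the operations of [QA n] and
   diverges there. *)
Section FieldIdentities.
Context {F : fieldType}.
Implicit Types a b c d l w x y : F.

Lemma mulf_commutator a b : a != 0 -> b != 0 -> a^-1 * (b^-1 * (a * b)) = 1.
Proof. by move=> a0 b0; field; rewrite a0 b0. Qed.

Lemma fox_winv_step l w x y : l != 0 -> w != 0 ->
  - w^-1 * x + w^-1 * (- l^-1 * y + l^-1 * 0) = - (l * w)^-1 * (y + l * x).
Proof. by move=> l0 w0; field; rewrite l0 w0. Qed.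

Lemma fox_comm_step a b x y : a != 0 -> b != 0 ->
  - a^-1 * x + a^-1 * (- b^-1 * y + b^-1 * (x + a * y)) =
  a^-1 * b^-1 * ((1 - b) * x + (a - 1) * y).
Proof. by move=> a0 b0; field; rewrite a0 b0. Qed.

Lemma fox_conj_step a x y : a != 0 ->
  - a^-1 * y + a^-1 * (x + 1 * y) = a^-1 * x.
Proof. by move=> a0; field. Qed.

Lemma oppV_mulB1 a : a != 0 -> - a^-1 * (a - 1) = a^-1 - 1.
Proof. by move=> a0; field. Qed.

Lemma fox_cancel_step l x : l != 0 -> x + l * (- l^-1 * x + l^-1 * 0) = 0.
Proof. by move=> l0; field. Qed.

End FieldIdentities.

Section Words.
Context {n : nat}.
Implicit Types (w u v a b g h : word n) (i : 'I_n) (l : letter n).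

Lemma linvK : involutive (@linv n).
Proof. by case=> i b; rewrite /linv /= negbK. Qed.

Lemma winvK : involutive (@winv n).
Proof. by move=> w; rewrite /winv map_rev revK (mapK linvK). Qed.

Lemma winv_cat u v : winv (u ++ v) = winv v ++ winv u.
Proof. by rewrite /winv map_cat rev_cat. Qed.

Lemma winv_cons l w : winv (l :: w) = winv w ++ [:: linv l].
Proof. by rewrite /winv /= rev_cons cats1. Qed.

Lemma winv_comm a b : winv (comm a b) = comm b a.
Proof. by rewrite /comm !winv_cat !winvK !catA. Qed.

Lemma letterA_neq0 l : letterA l != 0.
Proof. by rewrite /letterA; case: l.2; rewrite ?invr_eq0 xA_neq0. Qed.

Lemma letterA_linv l : letterA (linv l) = (letterA l)^-1.
Proof. by case: l => i []; rewrite /letterA //= invrK. Qed.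

Lemma wordA_nil : wordA ([::] : word n) = 1.
Proof. by rewrite /wordA big_nil. Qed.

Lemma wordA_cons l w : wordA (l :: w) = letterA l * wordA w.
Proof. by rewrite /wordA big_cons. Qed.

Lemma wordA_cat u v : wordA (u ++ v) = wordA u * wordA v.
Proof. by rewrite /wordA big_cat. Qed.

Lemma wordA_neq0 w : wordA w != 0.
Proof.
elim: w => [|l w ih]; first by rewrite wordA_nil oner_neq0.
by rewrite wordA_cons mulf_neq0 ?letterA_neq0 ?ih.
Qed.

Lemma wordA_winv w : wordA (winv w) = (wordA w)^-1.
Proof.
elim: w => [|l w ih]; first by rewrite wordA_nil invr1.
rewrite winv_cons wordA_cat ih wordA_cons wordA_nil mulr1 wordA_cons.
by rewrite letterA_linv invfM mulrC.
Qed.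

Lemma wordA_comm a b : wordA (comm a b) = 1.
Proof.
by rewrite /comm !wordA_cat !wordA_winv mulf_commutator ?wordA_neq0.
Qed.

Lemma wordA_conj a g : wordA (conj a g) = wordA a.
Proof. by rewrite /conj !wordA_cat wordA_winv mulrCA mulVf ?mulr1 ?wordA_neq0. Qed.

Lemma fox_cat i u v : fox i (u ++ v) = fox i u + wordA u * fox i v.
Proof.
elim: u => [|l u ih] /=; first by rewrite wordA_nil mul1r add0r.
by rewrite ih wordA_cons mulrDr addrA mulrA.
Qed.

Lemma fox_linv i l : fox_letter i (linv l) = - (letterA l)^-1 * fox_letter i l.
Proof.
case: l => j b; rewrite /fox_letter /letterA /=; case: eqP => [->|_].
  by case: b => /=; rewrite ?mulr1 // invrK mulrNN divff ?xA_neq0.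
by rewrite mulr0.
Qed.

Lemma fox_winv i w : fox i (winv w) = - (wordA w)^-1 * fox i w.
Proof.
elim: w => [|l w ih]; first by rewrite mulr0.
rewrite winv_cons fox_cat ih wordA_winv wordA_cons /= fox_linv letterA_linv.
by rewrite fox_winv_step ?letterA_neq0 ?wordA_neq0.
Qed.

Lemma fox_comm i a b :
  fox i (comm a b) =
    (wordA a)^-1 * (wordA b)^-1 *
    ((1 - wordA b) * fox i a + (wordA a - 1) * fox i b).
Proof.
rewrite /comm !fox_cat !fox_winv !wordA_winv.
by rewrite fox_comm_step ?wordA_neq0.
Qed.

Lemma fox_conj i a g :
  wordA a = 1 -> fox i (conj a g) = (wordA g)^-1 * fox i a.
Proof.
move=> a1; rewrite /conj !fox_cat !fox_winv !wordA_winv a1.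
by rewrite fox_conj_step ?wordA_neq0.
Qed.

Lemma fox_fundamental w : \sum_i fox i w * (xA i - 1) = wordA w - 1.
Proof.
elim: w => [|l w ih].
  by rewrite wordA_nil subrr big1 // => i _; rewrite mul0r.
have hl : \sum_i fox_letter i l * (xA i - 1) = letterA l - 1.
  rewrite (bigD1 l.1) //= big1 => [|i /negbTE il]; last first.
    by rewrite /fox_letter eq_sym il mul0r.
  rewrite addr0 /fox_letter eqxx /letterA; case: l.2; last by rewrite mul1r.
  by rewrite oppV_mulB1 ?xA_neq0.
under eq_bigr do rewrite /= mulrDl -mulrA.
by rewrite big_split /= -mulr_sumr ih hl wordA_cons; ring.
Qed.

Lemma wordA_meq u v : meq u v -> wordA u = wordA v.
Proof.
elim=> //= [{}u {}v w _ -> _ -> //|{}u u' {}v v' _ e1 _ e2|l|a b c d].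
- by rewrite !wordA_cat e1 e2.
- by rewrite !wordA_cons wordA_nil letterA_linv mulr1 divff ?letterA_neq0.
- by rewrite wordA_comm wordA_nil.
Qed.

(** The derivatives descend to [M_n]: for a commutator of two commutators, both coefficients
    [1 - wordA b] and [wordA a - 1] in [fox_comm] vanish. *)
Lemma fox_meq i u v : meq u v -> fox i u = fox i v.
Proof.
elim=> //= [{}u {}v w _ -> _ -> //|{}u u' {}v v' m1 e1 m2 e2|l|a b c d].
- by rewrite !fox_cat e1 e2 (wordA_meq m1).
- by rewrite fox_linv letterA_linv fox_cancel_step ?letterA_neq0.
- by rewrite fox_comm !wordA_comm; ring.
Qed.

Lemma evalA_wordA w : evalA (wordA w) 1.
Proof.
elim: w => [|l w ih]; first by rewrite wordA_nil; exact: (evalAZ 1).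
rewrite wordA_cons -[1]mulr1; apply: evalAM => //.
by rewrite /letterA; case: l.2; [exact: evalA_xAV|exact: evalA_xA].
Qed.

Lemma inZA_wordA w : inZA (wordA w).
Proof. by apply/inZA_evalA; exists 1; apply: evalA_wordA. Qed.

(** * Exponent sums as augmentations of Fox derivatives *)

Definition expsum i w : int := \sum_(l <- w | l.1 == i) (-1) ^+ l.2.

Lemma evalA_fox i w : evalA (fox i w) (expsum i w).
Proof.
rewrite /expsum; elim: w => [|l w ih]; first by rewrite big_nil; exact: (evalAZ 0).
rewrite big_mkcond big_cons -big_mkcond /=; apply: evalAD; last first.
  rewrite -[\sum_(_ <- _ | _) _]mul1r; apply: evalAM => //.
  by have := evalA_wordA [:: l]; rewrite wordA_cons wordA_nil mulr1.
rewrite /fox_letter; case: eqP => _; last exact: (evalAZ 0).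
case: l.2; last exact: (evalAZ 1).
by apply: evalAN; exact: evalA_xAV.
Qed.

Lemma inZA_fox i w : inZA (fox i w).
Proof. by apply/inZA_evalA; exists (expsum i w); apply: evalA_fox. Qed.

Lemma delta_primitive_expsum h i : delta_primitive h -> expsum i h = 0.
Proof.
move=> [/(_ i) /inDelta_evalA hd _].
exact: evalA_inj (evalA_fox i h) hd.
Qed.

End Words.

(* A signed list in which every label has total sign zero can be emptied by
   removing pairs of opposite entries. *)
Lemma signed_list_ind (T : eqType) (S : Type) (lab : S -> T) (sg : S -> bool)
    (P : seq S -> Prop) :
  P [::] ->
  (forall s t u v, lab s = lab t -> sg t = ~~ sg s ->
     P (u ++ v) -> P (s :: u ++ t :: v)) ->
  forall L, (forall x, \sum_(s <- L | lab s == x) (-1) ^+ sg s = 0 :> int) ->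
  P L.
Proof.
move=> P0 Pc L; have [m] := ubnP (size L).
elim: m L => // m ih [|s L] //= hs bal.
have [hL|hL] := boolP (has (fun t => (lab t == lab s) && (sg t == ~~ sg s)) L).
  case: (split_find hL) => {}t u v /andP[/eqP lt /eqP st] _ in hs bal *.
  rewrite cat_rcons; apply: Pc => //; apply: ih => [|x].
    by move: hs; rewrite !size_cat size_rcons; lia.
  have := bal x; rewrite cat_rcons big_cons !big_cat big_cons /= lt st.
  have sE (a b : int) (c : bool) : (-1) ^+ c + (a + ((-1) ^+ (~~ c) + b)) = a + b.
    by rewrite signrN; ring.
  by case: (lab s == x) => //; rewrite sE.
(* Without an opposite partner, all entries with the label of [s] carry its sign, so their total is
   nonzero. *)
have := bal (lab s); rewrite big_cons eqxx.
suff -> : \sum_(t <- L | lab t == lab s) (-1) ^+ sg t =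
          \sum_(t <- L | lab t == lab s) (-1) ^+ sg s :> int.
  by rewrite big_const_seq iter_addr_0; case: (sg s) => /=; lia.
elim: L hL {ih hs bal} => [|t L ih] /=; first by rewrite !big_nil.
rewrite negb_or => /andP[ht /ih e]; rewrite !big_cons e.
by case: eqP ht => //= _; case: (sg s); case: (sg t).
Qed.

Lemma expsum0_wordA n (w : word n) : (forall i, expsum i w = 0) -> wordA w = 1.
Proof.
move: w; apply: (signed_list_ind (P := fun w => wordA w = 1)) => [|s t u v].
  exact: wordA_nil.
move=> e1 e2; have -> : t = linv s by rewrite /linv e1 -e2; case: (t).
move=> uv1; rewrite wordA_cons wordA_cat wordA_cons letterA_linv.
by rewrite (mulrCA (wordA u)) mulVKf ?letterA_neq0 // -wordA_cat.
Qed.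

Lemma delta_primitive_wordA n (h : word n) : delta_primitive h -> wordA h = 1.
Proof. by move=> hd; apply: expsum0_wordA => i; apply: delta_primitive_expsum. Qed.

(** * Odd rank *)

Section FirstOrderPart.
Context {n : nat}.
Implicit Types (p q : {mpoly int[n]}) (i j k l : 'I_n).

(** The coefficient of [x_k - 1] in the Taylor expansion of [p] at the point with all coordinates
    1. *)
Definition mderiv1 k p : int := (p^`M(k)).@[fun _ => 1].

Lemma mderiv1M k p q :
  mderiv1 k (p * q) =
    mderiv1 k p * q.@[fun _ => 1] + p.@[fun _ => 1] * mderiv1 k q.
Proof. by rewrite /mderiv1 mderivM rmorphD !rmorphM. Qed.

Lemma mderiv1_sum k (I : finType) (F : I -> {mpoly int[n]}) :
  mderiv1 k (\sum_i F i) = \sum_i mderiv1 k (F i).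
Proof. by rewrite /mderiv1 (raddf_sum (mderiv k)) rmorph_sum. Qed.

Lemma mderivXB1 k i : ('X_i - 1 : {mpoly int[n]})^`M(k) = (i == k)%:R.
Proof.
rewrite mderivB -[1]/(1%:MP) mderivC subr0 mderivX mnm1E.
by case: eqP => [->|_]; rewrite ?scale0r // scale1r -[X in (X - _)%MM]add0m addmK mpolyX0.
Qed.

Lemma meval_nat (m : nat) : (m%:R : {mpoly int[n]}).@[fun _ => 1] = m%:R.
Proof. by rewrite rmorph_nat. Qed.

Lemma meval_XB1 i : ('X_i - 1 : {mpoly int[n]}).@[fun _ => 1] = 0.
Proof. by rewrite mevalB mevalXU meval1 subrr. Qed.

Lemma mderiv1_XB1 k i : mderiv1 k ('X_i - 1) = (i == k)%:R.
Proof. by rewrite /mderiv1 mderivXB1 meval_nat. Qed.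

(* The second derivatives of the relation at [1]. *)
Lemma relation_antisym (p : 'I_n -> {mpoly int[n]}) :
  \sum_i p i * ('X_i - 1) = 0 -> (forall i, (p i).@[fun _ => 1] = 0) ->
  forall k l, mderiv1 l (p k) = - mderiv1 k (p l).
Proof.
move=> rel p0 k l; apply/eqP; rewrite -addr_eq0; apply/eqP.
have := congr1 (fun q => mderiv1 k (q^`M(l))) rel.
rewrite /= (raddf_sum (mderiv l)) /= mderiv1_sum mderiv0 {2}/mderiv1 mderiv0 meval0 => <-.
(* At 1 only the terms with one derivative on each factor survive, since [p i] and [x_i - 1] both
   vanish there. *)
have -> : \sum_i mderiv1 k (p i * ('X_i - 1))^`M(l) =
    \sum_i (mderiv1 l (p i) * (i == k)%:R + mderiv1 k (p i) * (i == l)%:R).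
  apply: eq_bigr => i _; rewrite mderivM mderivXB1 {1}/mderiv1 mderivD rmorphD /=.
  rewrite -!/(mderiv1 _ _) !mderiv1M meval_XB1 p0 mul0r addr0 mulr0 add0r.
  by rewrite mderiv1_XB1 !meval_nat.
have sel (F : 'I_n -> int) j : \sum_i F i * (i == j)%:R = F j.
  rewrite (bigD1 j) //= eqxx mulr1 big1 ?addr0 // => i /negbTE->.
  by rewrite mulr0.
by rewrite big_split /= !sel.
Qed.

End FirstOrderPart.

Lemma odd_antisym_det (n : nat) (C : 'M[int]_n) :
  odd n -> C^T = - C -> \det C = 0.
Proof.
move=> n_odd CT; have := det_tr C.
rewrite CT -scaleN1r detZ -signr_odd n_odd expr1 mulN1r => /eqP.
by rewrite Num.Theory.eqNr => /eqP.
Qed.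

Lemma laurentMl n k (p q : {mpoly int[n]}) :
  laurent k (p * q) = laurent k p * toQA q.
Proof. by rewrite -laurent0 laurentM addn0. Qed.

(* Modulo the square of the augmentation ideal, the matrix of the Fox
   derivatives in terms of the [x_i - 1] is integral, invertible and
   alternating. *)
Lemma odd_not_delta_primitive n (h : word n) : odd n -> ~ delta_primitive h.
Proof.
move=> n_odd hd; have h1 := delta_primitive_wordA hd.
case: (hd) => hD /fin_all_exists[c hc].
have [k [p hp]] := inZA_common (fun i => inZA_fox i h).
have [l [q hq]] : exists l (q : 'I_n * 'I_n -> {mpoly int[n]}),
    forall ji, c ji.1 ji.2 = laurent l (q ji).
  by apply: inZA_common => ji; case: (hc ji.1).
have p0 i : (p i).@[fun _ => 1] = 0.
  apply: (@evalA_inj _ (fox i h)); last exact/inDelta_evalA/hD.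
  by exists k, (p i); split; first exact: hp.
have rel : \sum_i p i * ('X_i - 1) = 0.
  apply: (@laurent_inj _ k); rewrite laurent_sum.
  transitivity (wordA h - 1); last by rewrite h1 subrr /laurent raddf0 mul0r.
  rewrite -fox_fundamental; apply: eq_bigr => i _.
  by rewrite laurentMl hp rmorphB rmorph1.
have gen j : ('X_j - 1) * monoA n ^+ (l + k) = \sum_i q (j, i) * p i.
  apply: (@laurent_inj _ (0 + (l + k))); rewrite laurentMX laurent0 laurent_sum.
  rewrite rmorphB rmorph1 (hc j).2; apply: eq_bigr => i _.
  by rewrite add0n -laurentM -hp -(hq (j, i)).
pose C := \matrix_(i, k) mderiv1 k (p i).
pose B := \matrix_(j, i) (q (j, i)).@[fun _ => 1].
(* This is the linear part of [gen]: the [p i] have augmentation zero, so only the augmentations [B]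
   of the coefficients contribute. *)
have BC : B *m C = 1%:M.
  apply/matrixP => j m; rewrite !mxE; under eq_bigr do rewrite !mxE.
  have := congr1 (mderiv1 m) (gen j); rewrite mderiv1_sum mderiv1M.
  rewrite meval_XB1 mul0r addr0 meval_monoAX mulr1.
  rewrite mderiv1_XB1 => ->.
  by apply: eq_bigr => i _; rewrite mderiv1M p0 mulr0 add0r.
have CT : C^T = - C.
  by apply/matrixP => i j; rewrite !mxE; exact: relation_antisym.
have := congr1 determinant BC.
by rewrite det_mulmx det1 (odd_antisym_det n_odd CT) mulr0.
Qed.

(** * Linear independence of monomials *)

Section Monomials.
Context {n : nat}.
Implicit Types (w u v a b g h : word n) (i j : 'I_n) (l : letter n).

Lemma expsum_cons i l w :
  expsum i (l :: w) = (if l.1 == i then (-1) ^+ l.2 else 0) + expsum i w.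
Proof. by rewrite /expsum big_cons; case: eqP => // _; rewrite add0r. Qed.

Lemma expsum_cat i u v : expsum i (u ++ v) = expsum i u + expsum i v.
Proof. by rewrite /expsum big_cat. Qed.

Lemma expsum_winv i w : expsum i (winv w) = - expsum i w.
Proof.
elim: w => [|l w ih]; first by rewrite /expsum !big_nil oppr0.
rewrite winv_cons expsum_cat ih !expsum_cons /expsum big_nil addr0 opprD addrC.
by case: l => j b /=; case: eqP => // _; rewrite ?oppr0 // signrN.
Qed.

Lemma expsum_comm i a b : expsum i (comm a b) = 0.
Proof. by rewrite /comm !expsum_cat !expsum_winv; ring. Qed.

Lemma expsum_size i w : `|expsum i w| <= (size w)%:Z.
Proof.
elim: w => [|l w ih]; first by rewrite /expsum big_nil normr0.
have -> : (size (l :: w))%:Z = 1 + (size w)%:Z by rewrite /= -addn1 PoszD addrC.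
rewrite expsum_cons (le_trans (ler_normD _ _)) // lerD //.
by case: eqP => // _; rewrite normrX normrN1 expr1n.
Qed.

Definition expsums w : {ffun 'I_n -> int} := [ffun i => expsum i w].

(* The exponent of [x^e m^K], where [m = x_1...x_n]. *)
Definition shiftmn (K : nat) (e : {ffun 'I_n -> int}) : 'X_{1..n} :=
  [multinom absz (e i + K%:Z)%R | i < n].

Lemma monoAE : monoA n = 'X_[[multinom 1%N | i < n]].
Proof. by rewrite mpolyXE_id; apply: eq_bigr => i _; rewrite mnmE expr1. Qed.

Lemma letterA_monomial l : letterA l = laurent 1 'X_[shiftmn 1 (expsums [:: l])].
Proof.
rewrite /laurent expr1; apply: (canRL (mulfK (toQA_monoA_neq0 n 1))).
rewrite expr1 mpolyXE_id !rmorph_prod (bigD1 l.1) //= mulrA.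
rewrite [RHS](bigD1 l.1) //=; congr (_ * _); last first.
  apply: eq_bigr => i /negbTE il; rewrite mnmE ffunE expsum_cons eq_sym il.
  by rewrite /expsum big_nil /= expr1.
rewrite mnmE ffunE expsum_cons eqxx /expsum big_nil addr0 rmorphXn /=.
rewrite /letterA; case: l.2 => /=; first by rewrite mulVf ?xA_neq0.
by rewrite -expr2.
Qed.

(** The length of a word bounds its exponents, so shifting by [K] makes them non-negative and [absz]
    changes nothing. *)
Lemma wordA_monomial (K : nat) w :
  (size w <= K)%N -> wordA w = laurent K 'X_[shiftmn K (expsums w)].
Proof.
elim: w K => [|l w ih] K /=.
  move=> _; rewrite wordA_nil /laurent monoAE -rmorphXn mpolyXn /=.
  rewrite (_ : shiftmn _ _ = [multinom 1%N | i < n] *+ K)%MM ?divff //.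
    by have := toQA_monoA_neq0 n K; rewrite monoAE -rmorphXn mpolyXn.
  apply/mnmP => i; rewrite mulmnE !mnmE ffunE /expsum big_nil add0r mul1n.
  by rewrite absz_nat.
case: K => // K wK; rewrite wordA_cons (ih K wK) letterA_monomial laurentM.
rewrite -mpolyXD add1n; congr (laurent _ 'X_[_]); apply/mnmP => i.
rewrite mnmDE !mnmE !ffunE [expsum i (l :: w)]expsum_cons.
have := expsum_size i w; have := expsum_size i [:: l].
rewrite expsum_cons [expsum i [::]]/expsum big_nil addr0 /=.
move: (expsum i w) (if _ then _ else _) => x y; lia.
Qed.

(** Over a common denominator, the coefficient at [shiftmn K e] collects exactly the entries with
    exponent vector [e]. The conclusion is the balance condition of [signed_list_ind]. *)
Lemma wordA_independent (S : eqType) (L : seq S) (W : S -> word n) (sg : S -> bool) :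
  \sum_(s <- L) (-1) ^+ sg s * wordA (W s) = 0 ->
  forall e, \sum_(s <- L | expsums (W s) == e) (-1) ^+ sg s = 0 :> int.
Proof.
(* [K] bounds the entries of [e] as well as all word lengths, so [shiftmn K] separates the exponent
   vectors involved. *)
move=> rel e; pose K := (\max_(s <- L) size (W s) + \max_i `|e i|)%N.
have LK s : s \in L -> (size (W s) <= K)%N.
  move=> sL; apply: leq_trans (leq_addr _ _).
  exact: (leq_bigmax_seq (F := fun s => size (W s))).
have eK i : (`|e i| <= K)%N.
  apply: leq_trans (leq_addl _ _).
  exact: (leq_bigmax (F := fun i => `|e i|%N)).
have rel' : \sum_(s <- L) (-1) ^+ sg s *: 'X_[shiftmn K (expsums (W s))] = 0
    :> {mpoly int[n]}.
  apply: (@laurent_inj _ K); rewrite {2}/laurent raddf0 mul0r -[RHS]rel.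
  rewrite laurent_sum; apply: eq_big_seq => s sL.
  rewrite (wordA_monomial (LK s sL)) /laurent -mul_mpolyC rmorphM /= mulrA.
  by rewrite rmorph_sign /= rmorph_sign.
have := congr1 (mcoeff (shiftmn K e)) rel'; rewrite mcoeff0 raddf_sum => rel0.
rewrite -[RHS]rel0 big_mkcond; apply: eq_big_seq => s sL; rewrite /= mcoeffZ mcoeffX.
have -> : (shiftmn K (expsums (W s)) == shiftmn K e) = (expsums (W s) == e).
  apply/eqP/eqP => [eqm|->] //; apply/ffunP => i.
  have := congr1 (fun m : 'X_{1..n} => m i) eqm.
  rewrite /= !mnmE; have := eK i; have := LK s sL.
  have := expsum_size i (W s); rewrite -(ffunE (fun i => expsum i (W s))).
  rewrite -/(expsums _); move: (expsums (W s) i) (e i) => x y; lia.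
by case: eqP; rewrite ?mulr1 ?mulr0.
Qed.

Lemma monomial_wordA k (m : 'X_{1..n}) : exists w, wordA w = laurent k 'X_[m].
Proof.
have pr (F : 'I_n -> QA n) (e : 'I_n -> nat) :
    (forall i, exists w, wordA w = F i) -> exists w, wordA w = \prod_i F i ^+ e i.
  move=> hF; apply: (big_ind (fun x => exists w, wordA w = x)) => [|x y [u <-] [v <-]|i _].
  - by exists [::]; rewrite wordA_nil.
  - by exists (u ++ v); rewrite wordA_cat.
  have [w <-] := hF i; elim: (e i) => [|d [u hu]].
    by exists [::]; rewrite wordA_nil.
  by exists (w ++ u); rewrite wordA_cat hu exprS.
have hx i : exists w, wordA w = xA i.
  by exists (gen i); rewrite wordA_cons wordA_nil mulr1.
have [u hu] := pr xA m hx; have [v hv] := pr xA (fun=> k) hx.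
exists (u ++ winv v); rewrite wordA_cat wordA_winv hu hv /laurent.
rewrite mpolyXE_id rmorph_prod /monoA rmorph_prod -prodrXl.
by congr (_ / _); apply: eq_bigr => i _; rewrite rmorphXn.
Qed.

End Monomials.

(** * Identities in the free metabelian group *)

#[export] Hint Resolve meq_refl : core.

Section FreeMetabelian.
Context {n : nat}.
Implicit Types (w u v a b c g h x y : word n) (i j : 'I_n) (l : letter n).

#[export] Instance meq_equivalence : RelationClasses.Equivalence (@meq n).
Proof. by split; [exact: meq_refl | exact: meq_sym | exact: meq_trans]. Qed.

#[export] Instance cat_meq :
  Morphisms.Proper (Morphisms.respectful meq (Morphisms.respectful meq meq))
    (@cat (letter n)).
Proof. by move=> u u' e v v' f; exact: meq_cat. Qed.

Lemma meq_winvl w : meq (winv w ++ w) [::].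
Proof.
elim: w => [|l w ih]; first exact: meq_refl.
rewrite winv_cons -catA (_ : [:: linv l] ++ _ = [:: linv l; linv (linv l)] ++ w).
  by rewrite meq_cancel.
by rewrite linvK.
Qed.

Lemma meq_winvr w : meq (w ++ winv w) [::].
Proof. by rewrite -{1}[w]winvK; exact: meq_winvl. Qed.

Lemma meq_winvKl u w : meq (winv u ++ u ++ w) w.
Proof. by rewrite catA meq_winvl. Qed.

Lemma meq_winvKr u w : meq (u ++ winv u ++ w) w.
Proof. by rewrite catA meq_winvr. Qed.

End FreeMetabelian.

Ltac free_reduce :=
  rewrite /conj /comm ?winv_cat ?winvK -?catA ?cats0 /=;
  repeat first [rewrite meq_winvKl | rewrite meq_winvKr
               | rewrite meq_winvl | rewrite meq_winvr | rewrite cats0];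
  try reflexivity.

Section FreeMetabelianTheory.
Context {n : nat}.
Implicit Types (w u v a b c g h x y : word n) (i j : 'I_n) (l : letter n).

#[export] Instance winv_meq :
  Morphisms.Proper (Morphisms.respectful meq meq) (@winv n).
Proof.
(* Insert [v ++ winv v] after [winv u] and turn its first factor into [u], which then cancels. *)
move=> u v e; rewrite -[winv u]cats0 -(meq_winvr v) -{1}e.
by free_reduce.
Qed.

#[export] Instance conj_meq :
  Morphisms.Proper (Morphisms.respectful meq (Morphisms.respectful meq meq))
    (@conj n).
Proof. by move=> u u' e v v' f; rewrite /conj e f. Qed.

#[export] Instance comm_meq :
  Morphisms.Proper (Morphisms.respectful meq (Morphisms.respectful meq meq))
    (@comm n).
Proof. by move=> u u' e v v' f; rewrite /comm e f. Qed.

Lemma conj_cat a b g : meq (conj (a ++ b) g) (conj a g ++ conj b g).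
Proof. by free_reduce. Qed.

Lemma conj_conj a g h : conj (conj a g) h = conj a (g ++ h).
Proof. by rewrite /conj winv_cat !catA. Qed.

Lemma conj_nil a : conj a [::] = a.
Proof. by rewrite /conj cats0. Qed.

Lemma winv_conj a g : winv (conj a g) = conj (winv a) g.
Proof. by rewrite /conj !winv_cat winvK !catA. Qed.

Lemma conj_comm a b g : meq (conj (comm a b) g) (comm (conj a g) (conj b g)).
Proof. by free_reduce. Qed.

Lemma conj_commute a g : meq (a ++ g) (g ++ a) -> meq (conj a g) a.
Proof. by move=> e; rewrite /conj e; free_reduce. Qed.

Lemma comm_catl u v w : meq (comm (u ++ v) w) (conj (comm u w) v ++ comm v w).
Proof. by free_reduce. Qed.

Lemma comm_catr u v w : meq (comm u (v ++ w)) (comm u w ++ conj (comm u v) w).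
Proof. by free_reduce. Qed.

(** Removes the pair [a], [winv a] from a word at the cost of a conjugated commutator. *)
Lemma cat_conj_comm a u v :
  meq ((u ++ v) ++ conj (comm u (winv a)) v) (a ++ u ++ winv a ++ v).
Proof. by free_reduce. Qed.

Lemma comm_nill v : meq (comm [::] v) [::].
Proof. exact: meq_winvl. Qed.

Lemma comm_nilr u : meq (comm u [::]) [::].
Proof. by rewrite /comm cats0; exact: meq_winvl. Qed.

Lemma comm_winvl u v : meq (comm (winv u) v) (conj (comm v u) (winv u)).
Proof. by free_reduce. Qed.

Lemma comm_winvr u v : meq (comm u (winv v)) (conj (comm v u) (winv v)).
Proof. by free_reduce. Qed.

(** Conjugation passes inside a commutator, so this is the metabelian law for conjugated
    arguments. *)
Lemma commutator_commute a b c d g h :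
  meq (conj (comm a b) g ++ conj (comm c d) h)
      (conj (comm c d) h ++ conj (comm a b) g).
Proof.
have := meq_metab (conj a g) (conj b g) (conj c h) (conj d h).
rewrite -!conj_comm; move: (conj (comm a b) g) (conj (comm c d) h) => u v e.
by rewrite -[u ++ v]cats0 -(meq_winvl (v ++ u)) -[X in meq _ X]cats0 -e; free_reduce.
Qed.

Lemma cat_meq_nil u v : meq (winv u ++ v) [::] -> meq v u.
Proof. by move=> e; rewrite -[u in X in meq _ X]cats0 -e; free_reduce. Qed.

End FreeMetabelianTheory.

(** * Common divisors of x_1 - 1 and x_2 - 1 *)

(** Once the powers of ['X] are split off, the cofactors have nonzero constant terms. The lowest
    term then forces their product to be the constant [c], so both have degree zero. *)
Lemma monomial_divisor (R : idomainType) (a b : {poly R}) (c : R) k :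
  c != 0 -> a * b = c *: 'X^k -> exists d j, a = d *: 'X^j.
Proof.
move=> c0 ab.
have ab0 : a * b != 0 
    by rewrite ab -mul_polyC mulf_neq0 ?polyC_eq0 ?monic_neq0 ?monicXn.
move: (ab0); rewrite mulf_eq0 negb_or => /andP[a0 b0].
have [i [a1 r1 ea]] := multiplicity_XsubC a 0.
have [j [b1 r2 eb]] := multiplicity_XsubC b 0.
rewrite a0 /= in r1; rewrite b0 /= in r2; rewrite subr0 in ea eb.
have ab1 : a1 * b1 * 'X^(i + j) = c *: 'X^k.
  by rewrite -ab ea eb exprD; ring.
have low : (a1 * b1)`_0 != 0 by rewrite -horner_coef0 hornerM mulf_neq0.
have kij : k = (i + j)%N.
  have := congr1 (coefp (i + j)) ab1; rewrite /= coefMXn ltnn subnn coefZ coefXn.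
  by case: eqP => [->//|_ e]; rewrite e mulr0 eqxx in low.
have {}ab1 : a1 * b1 = c%:P.
  apply: (mulIf (monic_neq0 (monicXn R (i + j)))).
  by rewrite ab1 kij mul_polyC.
have : size a1 == 1%N.
  have: (size (a1 * b1)%R <= 1)%N by rewrite ab1 size_polyC_leq1.
  have a10 : a1 != 0 by apply: contraNneq r1 => ->; rewrite root0.
  have b10 : b1 != 0 by apply: contraNneq r2 => ->; rewrite root0.
  rewrite size_mul // eqn_leq size_poly_gt0 a10 andbT.
  move: b10; rewrite -size_poly_gt0; case: (size b1) => // s _.
  by rewrite addnS; apply: leq_trans (leq_addr _ _).
move=> /size_poly1P[d _ ea1]; exists d, i.
by rewrite ea ea1 mul_polyC.
Qed.

Section Grading.
Context {n : nat} (i : 'I_n).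
Implicit Types (p q : {mpoly int[n]}) (m : 'X_{1..n}).

(* The grading by the exponent of [x_i], as the ring morphism
   [x_i |-> x_i T], [x_j |-> x_j]. *)
Definition grading p : {poly {mpoly int[n]}} :=
  mmap (polyC \o @mpolyC n int) (fun j => ('X_j)%:P * 'X^(j == i)) p.

Lemma gradingX m : grading 'X_[m] = 'X_[m] *: 'X^(m i).
Proof.
rewrite /grading mmapX /mmap1 -mul_polyC mpolyXE_id rmorph_prod.
rewrite (bigD1 i) //= [in RHS](bigD1 i) //= eqxx expr1.
rewrite exprMn rmorphXn /= mulrAC; congr (_ * _ * _).
by apply: eq_bigr => j /negbTE ->; rewrite mulr1 rmorphXn.
Qed.

Lemma gradingM p q : grading (p * q) = grading p * grading q.
Proof. by rewrite /grading rmorphM. Qed.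

Lemma gradingB1 j : j != i -> grading ('X_j - 1) = ('X_j - 1)%:P.
Proof.
move=> /negbTE ji; rewrite /grading rmorphB rmorph1 /= mmapX mmap1U ji.
by rewrite mulr1 rmorphB.
Qed.

Lemma coef_grading p k m : (grading p)`_k@_m = if m i == k then p@_m else 0.
Proof.
rewrite {1}[p]mpolyE /grading raddf_sum /= coef_sum raddf_sum /=.
rewrite [in RHS](mpolyE p) raddf_sum /=.
have -> (b : bool) x : (if b then x else 0) = b%:R * x :> int.
  by case: b; rewrite ?mul1r ?mul0r.
rewrite mulr_sumr; apply: eq_bigr => m' _.
rewrite mmapZ -/(grading _) gradingX /= mul_polyC !coefZ coefXn mcoeffCM.
rewrite mcoeffZ mcoeffX.
rewrite mulr_natr mcoeffMn mcoeffX -mulr_natr [k == _]eq_sym.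
by case: (m' =P m) => [->|_] /=; ring.
Qed.

(** The product is homogeneous in [x_i], so its grading is a monomial in [T]; by [monomial_divisor]
    the grading of [p] is one too. *)
Lemma homogeneous_divisor p q j m :
  j != i -> p * q = ('X_j - 1) * 'X_[m] ->
  exists d, forall m', m' \in msupp p -> m' i = d.
Proof.
move=> ji pq.
have : grading p * grading q = (('X_j - 1) * 'X_[m]) *: 'X^(m i).
  by rewrite -gradingM pq gradingM gradingB1 // gradingX mul_polyC scalerA.
case/monomial_divisor.
  rewrite mulf_neq0 //.
    apply/eqP => /(congr1 (mcoeff U_(j)%MM)).
    rewrite mcoeffB mcoeffXU eqxx mcoeff1 mcoeff0.
    by rewrite mnm1_eq0.
  by apply/eqP => /(congr1 (mcoeff m)); rewrite mcoeffX eqxx mcoeff0.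
move=> r [d e]; exists d => m'; apply: contraTeq => md.
have := coef_grading p (m' i) m'; rewrite eqxx e coefZ coefXn (negbTE md).
by rewrite mulr0 mcoeff0 => /esym/eqP; rewrite mcoeff_eq0.
Qed.

End Grading.

(** The multiple of [x_1 - 1] makes [p] homogeneous in [x_2], the multiple of [x_2 - 1] makes it
    homogeneous in [x_1]; a single monomial is left. *)
Lemma common_divisor_monomial (p q r : {mpoly int[2]}) (m m' : 'X_{1..2}) :
  p * q = ('X_ord0 - 1) * 'X_[m] -> p * r = ('X_ord_max - 1) * 'X_[m'] ->
  exists (b : bool) m0, p = (-1) ^+ b *: 'X_[m0].
Proof.
move=> pq pr.
have [d1 hd1] := homogeneous_divisor (i := @ord_max 1) (j := ord0) isT pq.
have [d0 hd0] := homogeneous_divisor (i := @ord0 1) (j := ord_max) isT pr.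
pose m0 : 'X_{1..2} := [multinom if i == ord0 then d0 else d1 | i < 2].
have ep : p = p@_m0 *: 'X_[m0].
  apply/mpolyP => k; rewrite mcoeffZ mcoeffX.
  have [<-|km] := eqVneq m0 k; first by rewrite mulr1.
  rewrite mulr0; apply/eqP; rewrite mcoeff_eq0; apply: contra km => kp.
  apply/eqP/mnmP => i; rewrite mnmE.
  have [->|i0] := eqVneq i ord0; first by rewrite hd0.
  by rewrite (_ : i = ord_max) ?hd1 //; case: i i0 => [[|[|]]] // *; apply: val_inj.
(* Comparing the coefficients of [x_1 x^m] shows that the coefficient of [p] is a unit of the
   integers. *)
have : p@_m0 * ('X_[m0] * q)@_(U_(ord0) + m) = 1.
  rewrite -mcoeffZ scalerAl -ep pq mulrBl mul1r mcoeffB -mpolyXD !mcoeffX eqxx.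
  by rewrite -[X in X == _]add0m (can_eq (addmK m)) eq_sym mnm1_eq0 subr0.
move: (p@_m0) ep => c ->; move: (('X_[m0] * q)@_(U_(ord0) + m)) => z cz.
have : (absz c * absz z == 1)%N by rewrite -abszM cz.
rewrite muln_eq1 => /andP[/eqP c1 _].
have [->|->] : c = 1 \/ c = -1 by lia.
  by exists false, m0.
by exists true, m0.
Qed.

(** Denominators are monomials, so clearing them leads to [common_divisor_monomial]; the monomial
    found is the image of a word by [monomial_wordA]. *)
Lemma common_divisor_unit (u a0 a1 : QA 2) :
  inZA u -> inZA a0 -> inZA a1 ->
  u * a0 = xA ord0 - 1 -> u * a1 = xA ord_max - 1 ->
  exists (b : bool) g, u = (-1) ^+ b * wordA g.
Proof.
move=> [k [p ep]] [j0 [q0 e0]] [j1 [q1 e1]] eq0 eq1.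
have clear_den j q i : laurent k p * laurent j q = xA i - 1 ->
    p * q = ('X_i - 1) * 'X_[[multinom 1%N | i < 2] *+ (k + j)].
  move=> e; apply: (@laurent_inj _ (0 + (k + j))).
  rewrite -mpolyXn -monoAE laurentMX laurent0 rmorphB rmorph1 -e.
  by rewrite laurentM add0n.
have [||b [m0 em]] := @common_divisor_monomial p q0 q1
  ([multinom 1%N | i < 2] *+ (k + j0)) ([multinom 1%N | i < 2] *+ (k + j1)).
- by apply: clear_den; rewrite /laurent -ep -e0.
- by apply: clear_den; rewrite /laurent -ep -e1.
have [g hg] := monomial_wordA k m0; exists b, g.
by rewrite hg ep em -mul_mpolyC rmorphM /= !rmorph_sign mulrA.
Qed.

(** * The derived subgroup in rank two *)

Section RankTwo.
Implicit Types (w u v g h : word 2) (l : letter 2) (x y : word 2 * bool).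
Implicit Types (G : seq (word 2 * bool)).

Let x1 : word 2 := gen (@ord0 1).
Let x2 : word 2 := gen (@ord_max 1).

(** The Boolean is a sign, [comm x2 x1] being inverse to [comm x1 x2]; a list of pairs stands for a
    group ring element acting on [[x_1,x_2]]. *)
Definition conj_gen x : word 2 :=
  conj (if x.2 then comm x2 x1 else comm x1 x2) x.1.
Definition conj_prod G : word 2 := flatten (map conj_gen G).
Definition commutator_subgroup w := exists G, meq w (conj_prod G).

Lemma conj_prod_cons x G : conj_prod (x :: G) = conj_gen x ++ conj_prod G.
Proof. by []. Qed.

Lemma conj_prod_cat G H : conj_prod (G ++ H) = conj_prod G ++ conj_prod H.
Proof. by rewrite /conj_prod map_cat flatten_cat. Qed.

#[local] Instance commutator_subgroup_meq :
  Morphisms.Proper (Morphisms.respectful meq iff) commutator_subgroup.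
Proof. by move=> u v e; split=> -[G hG]; exists G; rewrite -hG e. Qed.

Lemma commutator_subgroup1 : commutator_subgroup [::].
Proof. by exists [::]. Qed.

Lemma commutator_subgroupM u v :
  commutator_subgroup u -> commutator_subgroup v -> commutator_subgroup (u ++ v).
Proof.
move=> [G hG] [H hH]; exists (G ++ H).
by rewrite conj_prod_cat hG hH.
Qed.

Lemma commutator_subgroupJ u g :
  commutator_subgroup u -> commutator_subgroup (conj u g).
Proof.
move=> [G hG]; exists [seq (x.1 ++ g, x.2) | x <- G]; rewrite hG.
elim: G {hG} => [|x G ih]; first by free_reduce.
by rewrite /conj_prod /= conj_cat ih /conj_gen conj_conj.
Qed.

Lemma commutator_subgroup_comm_gen (i j : 'I_2) :
  commutator_subgroup (comm (gen i) (gen j)).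
Proof.
have base b : commutator_subgroup (conj_gen ([::], b)).
  by exists [:: ([::], b)]; rewrite /conj_prod /= cats0.
have triv u : commutator_subgroup (comm u u).
  by exists [::]; free_reduce.
have I2 (k : 'I_2) : k = ord0 \/ k = ord_max.
  by case: k => [[|[|//]] hk]; [left | right]; apply: val_inj.
case: (I2 i) (I2 j) => -> [] ->; [exact: triv| | |exact: triv].
  by have := base false; rewrite /conj_gen /conj /=.
by have := base true; rewrite /conj_gen /conj /=.
Qed.

(** Up to conjugation, [comm_catl] and [comm_catr] split both arguments into letters, and
    [comm_winvl] and [comm_winvr] reduce these to generators. *)
Lemma commutator_subgroup_comm u v : commutator_subgroup (comm u v).
Proof.
have Vl (a b : word 2) : commutator_subgroup (comm b a) -> commutator_subgroup (comm (winv a) b).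
  by move=> h; rewrite comm_winvl; apply: commutator_subgroupJ.
have Vr (a b : word 2) : commutator_subgroup (comm b a) -> commutator_subgroup (comm a (winv b)).
  by move=> h; rewrite comm_winvr; apply: commutator_subgroupJ.
have letter_gen l : [:: l] = gen l.1 \/ [:: l] = winv (gen l.1).
  by case: l => i []; [right | left].
have ll l l' : commutator_subgroup (comm [:: l] [:: l']).
  have g1 i k : commutator_subgroup (comm [:: k] (gen i)).
    case: (letter_gen k) => ->; first exact: commutator_subgroup_comm_gen.
    by apply: Vl; apply: commutator_subgroup_comm_gen.
  have g2 i k : commutator_subgroup (comm (gen i) [:: k]).
    case: (letter_gen k) => ->; first exact: commutator_subgroup_comm_gen.
    by apply: Vr; apply: commutator_subgroup_comm_gen.
  case: (letter_gen l') => ->; first exact: g1.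
  by apply: Vr; apply: g2.
have lw l w : commutator_subgroup (comm [:: l] w).
  elim: w => [|k w ih]; first by exists [::]; rewrite comm_nilr.
  rewrite -[k :: w]cat1s comm_catr; apply: commutator_subgroupM => //.
  exact: commutator_subgroupJ.
elim: u => [|l u ih]; first by exists [::]; rewrite comm_nill.
rewrite -[l :: u]cat1s comm_catl; apply: commutator_subgroupM => //.
exact: commutator_subgroupJ.
Qed.

(** Opposite letters are removed in pairs by [cat_conj_comm]. *)
Lemma expsum0_commutator_subgroup w :
  (forall i, expsum i w = 0) -> commutator_subgroup w.
Proof.
move: w; apply: (signed_list_ind (P := commutator_subgroup)) => [|s t u v].
  exact: commutator_subgroup1.
move=> e1 e2 huv; have -> : t = linv s by rewrite /linv e1 -e2; case: (t).
have : meq ((u ++ v) ++ conj (comm u (winv [:: s])) v) (s :: u ++ linv s :: v).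
  exact: (cat_conj_comm [:: s]).
move=> <-; apply: commutator_subgroupM => //.
by apply: commutator_subgroupJ; apply: commutator_subgroup_comm.
Qed.

Lemma conj_gen_comm x y : meq (conj_gen x ++ conj_gen y) (conj_gen y ++ conj_gen x).
Proof.
by rewrite /conj_gen; case: x.2; case: y.2; apply: commutator_commute.
Qed.

Lemma conj_prod_comm x G : meq (conj_gen x ++ conj_prod G) (conj_prod G ++ conj_gen x).
Proof.
rewrite /conj_prod; elim: G => [|y G ih] /=; first by rewrite cats0.
rewrite catA (conj_gen_comm x y) -(catA (conj_gen y) (conj_gen x)) ih.
by rewrite -(catA (conj_gen y)).
Qed.

Lemma winv_conj_gen g b : winv (conj_gen (g, b)) = conj_gen (g, ~~ b).
Proof. by rewrite /conj_gen winv_conj; case: b; rewrite /= winv_comm. Qed.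

(** Here [h] is [g] times an element of [M_2'], and that element commutes with all conjugates of
    [[x_1,x_2]] and its inverse. *)
Lemma conj_gen_expsum g h b :
  (forall i, expsum i g = expsum i h) -> meq (conj_gen (g, b)) (conj_gen (h, b)).
Proof.
move=> e.
have [G hG] : commutator_subgroup (winv g ++ h).
  by apply: expsum0_commutator_subgroup => i; rewrite expsum_cat expsum_winv e addNr.
have eh : meq h (g ++ conj_prod G) by rewrite -hG; free_reduce.
have e2 : meq (conj_gen (h, b)) (conj (conj_gen (g, b)) (conj_prod G)).
  have : meq (conj (if b then comm x2 x1 else comm x1 x2) h)
             (conj (if b then comm x2 x1 else comm x1 x2) (g ++ conj_prod G)).
    by rewrite -eh.
  by rewrite -conj_conj.
by rewrite e2 conj_commute // conj_prod_comm.
Qed.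

(** Independence of monomials balances the signs at each exponent vector. Entries of opposite sign
    and equal exponents are inverse by [conj_gen_expsum], and they cancel because all factors
    commute. *)
Lemma conj_prod_trivial G :
  \sum_(x <- G) (-1) ^+ x.2 * wordA (winv x.1) = 0 -> meq (conj_prod G) [::].
Proof.
move=> /wordA_independent; move: G.
apply: (signed_list_ind (P := fun G => meq (conj_prod G) [::])) => // s t u v e1 e2.
have est i : expsum i t.1 = expsum i s.1.
  have := congr1 (fun f : {ffun 'I_2 -> int} => f i) e1.
  by rewrite !ffunE !expsum_winv => /oppr_inj.
rewrite conj_prod_cons !conj_prod_cat conj_prod_cons => uv.
have -> : meq (conj_gen t) (winv (conj_gen s)).
  case: s t e2 est {e1} => [g b] [h b'] /= -> est.
  by rewrite winv_conj_gen; apply: conj_gen_expsum.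
by rewrite catA conj_prod_comm -(catA (conj_prod u)) meq_winvKr.
Qed.

Lemma wordA_conj_gen x : wordA (conj_gen x) = 1.
Proof. by rewrite /conj_gen wordA_conj; case: x.2; rewrite wordA_comm. Qed.

Lemma fox_conj_gen i x :
  fox i (conj_gen x) = (-1) ^+ x.2 * wordA (winv x.1) * fox i (comm x1 x2).
Proof.
rewrite /conj_gen wordA_winv; case: x.2; rewrite fox_conj ?wordA_comm //.
  by rewrite -winv_comm fox_winv wordA_comm invr1 /=; ring.
by rewrite expr0 mul1r.
Qed.

Lemma fox_conj_prod i G :
  fox i (conj_prod G) =
    (\sum_(x <- G) (-1) ^+ x.2 * wordA (winv x.1)) * fox i (comm x1 x2).
Proof.
rewrite /conj_prod; elim: G => [|x G ih]; first by rewrite big_nil mul0r.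
by rewrite /= fox_cat wordA_conj_gen mul1r ih fox_conj_gen big_cons mulrDl.
Qed.

Lemma delta_primitive_conj_gen h :
  delta_primitive h -> exists x, meq h (conj_gen x).
Proof.
move=> hd; have [G hG] := expsum0_commutator_subgroup (fun i => delta_primitive_expsum i hd).
set u := \sum_(x <- G) (-1) ^+ x.2 * wordA (winv x.1).
have hu i : fox i h = u * fox i (comm x1 x2) by rewrite (fox_meq i hG) fox_conj_prod.
have uZ : inZA u.
  apply: inZA_sum => x _; apply: inZAM; last exact: inZA_wordA.
  by have := inZA_int ((-1) ^+ x.2) (n := 2); rewrite rmorph_sign.
have gens j : exists2 a, inZA a & u * a = xA j - 1.
  have [c [cZ ->]] := hd.2 j; exists (\sum_i c i * fox i (comm x1 x2)).
    by apply: inZA_sum => i _; apply: inZAM => //; apply: inZA_fox.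
  by rewrite mulr_sumr; apply: eq_bigr => i _; rewrite hu mulrCA.
have [a0 a0Z e0] := gens ord0; have [a1 a1Z e1] := gens ord_max.
have [b [g ug]] := common_divisor_unit uZ a0Z a1Z e0 e1.
(* A conjugator enters [fox_conj_prod] through its inverse, hence [winv g]. Adding the pair of
   opposite sign makes the coefficient zero. *)
exists (winv g, b); rewrite hG.
have : meq (conj_prod ((winv g, ~~ b) :: G)) [::].
  apply: conj_prod_trivial; rewrite big_cons /= -/u ug winvK signrN.
  by rewrite mulNr addNr.
rewrite /conj_prod /= -winv_conj_gen; exact: cat_meq_nil.
Qed.

End RankTwo.

(** * Automorphisms *)

Section Substitution.
Context {n : nat}.
Implicit Types (w u v a b g h : word n) (s : 'I_n -> word n) (i j : 'I_n).

Lemma subst_cons s l w : subst s (l :: w) = subst_letter s l ++ subst s w.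
Proof. by []. Qed.

Lemma subst_cat s u v : subst s (u ++ v) = subst s u ++ subst s v.
Proof. by rewrite /subst map_cat flatten_cat. Qed.

Lemma subst_gen s i : subst s (gen i) = s i.
Proof. by rewrite /subst /= cats0. Qed.

Lemma subst_winv s w : subst s (winv w) = winv (subst s w).
Proof.
elim: w => [|l w ih] //; rewrite winv_cons subst_cat ih !subst_cons winv_cat.
by rewrite cats0 /subst_letter; case: l => j []; rewrite /= ?winvK.
Qed.

Lemma subst_comm s a b : subst s (comm a b) = comm (subst s a) (subst s b).
Proof. by rewrite /comm !subst_cat !subst_winv. Qed.

Lemma subst_conj s a g : subst s (conj a g) = conj (subst s a) (subst s g).
Proof. by rewrite /conj !subst_cat !subst_winv. Qed.

Lemma subst_meq s u v : meq u v -> meq (subst s u) (subst s v).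
Proof.
elim=> [//|{}u {}v _ -> //|{}u {}v w _ -> _ -> //|{}u u' {}v v' _ e1 _ e2|l|a b c d].
- by rewrite !subst_cat e1 e2.
- rewrite subst_cons -[[:: linv l]]/(winv [:: l]) subst_winv subst_cons cats0.
  exact: meq_winvr.
- by rewrite !subst_comm; exact: meq_metab.
Qed.

(* The chain rule, without identifying the coefficients [Y j] as the images of
   the Fox derivatives of [h]. *)
Lemma fox_subst s h :
  exists2 Y : 'I_n -> QA n, (forall j, inZA (Y j)) &
    forall i, fox i (subst s h) = \sum_j Y j * fox i (s j).
Proof.
elim: h => [|l h [Y YZ hY]].
  exists (fun=> 0) => [j|i]; first exact: inZA0.
  by rewrite big1 // => j _; rewrite mul0r.
pose t : QA n := if l.2 then - (wordA (s l.1))^-1 else 1.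
have tZ : inZA t.
  rewrite /t; case: l.2; last exact: inZA1.
  by apply: inZAN; rewrite -wordA_winv; exact: inZA_wordA.
have ht i : fox i (subst_letter s l) = t * fox i (s l.1).
  by rewrite /subst_letter /t; case: l.2; rewrite ?fox_winv ?mul1r.
exists (fun j => (if j == l.1 then t else 0) + wordA (subst_letter s l) * Y j).
  move=> j; apply: inZAD; first by case: eqP => _ //; exact: inZA0.
  by apply: inZAM => //; exact: inZA_wordA.
move=> i; rewrite subst_cons fox_cat hY ht mulr_sumr.
under [RHS]eq_bigr do rewrite mulrDl -mulrA.
rewrite big_split /=; congr (_ + _).
by rewrite (bigD1 l.1) //= eqxx big1 ?addr0 // => j /negbTE ->; rewrite mul0r.
Qed.

Lemma fox_gen i j : fox i (gen j) = (j == i)%:R.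
Proof. by rewrite /= /fox_letter /= mulr0 addr0; case: eqP. Qed.

(** Multiplying all derivatives by a unit preserves the ideal they generate; the coefficients absorb
    the inverse [v']. *)
Lemma delta_primitive_scale (v v' : QA n) h h' :
  inZA v -> inZA v' -> v * v' = 1 ->
  (forall i, fox i h' = v * fox i h) -> delta_primitive h -> delta_primitive h'.
Proof.
move=> vZ v'Z vv' e [hD hg]; split=> [i|j].
  apply/inDelta_evalA; rewrite e; case/inZA_evalA: vZ => z hz.
  by rewrite -(mulr0 z); apply: evalAM => //; exact/inDelta_evalA/hD.
have [c [cZ ->]] := hg j; exists (fun i => c i * v'); split=> [i|].
  exact: inZAM.
apply: eq_bigr => i _; rewrite e mulrA -(mulrA (c i)) (mulrC v') vv'.
by rewrite mulr1.
Qed.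

End Substitution.

Section DeterminantIdentities.
Context {F : fieldType}.
Implicit Types p q U V X Y : F.

(** [p, q] and [p', q'] stand for the derivatives of two words, [U] and [V] for the inverses of
    their images. [true%:R] and [false%:R] are the values left by [fox_gen]. *)
Lemma jacobian_identity0 U V X Y p q p' q' : X != 0 -> Y != 0 ->
  U * V * (- (p' * (X - 1) + q' * (Y - 1)) * p + (p * (X - 1) + q * (Y - 1)) * p')
  = U * V * (X * Y) * (p * q' - q * p') *
    (X^-1 * Y^-1 * ((1 - Y) * true%:R + (X - 1) * false%:R)).
Proof. by move=> X0 Y0 /=; field; rewrite X0 Y0. Qed.

Lemma jacobian_identity1 U V X Y p q p' q' : X != 0 -> Y != 0 ->
  U * V * (- (p' * (X - 1) + q' * (Y - 1)) * q + (p * (X - 1) + q * (Y - 1)) * q')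
  = U * V * (X * Y) * (p * q' - q * p') *
    (X^-1 * Y^-1 * ((1 - Y) * false%:R + (X - 1) * true%:R)).
Proof. by move=> X0 Y0 /=; field; rewrite X0 Y0. Qed.

Lemma unit_identity U V X Y : U != 0 -> V != 0 -> X != 0 -> Y != 0 ->
  (U^-1 * V^-1 * (X * Y)) * (U * V * (X^-1 * Y^-1)) = 1.
Proof. by move=> U0 V0 X0 Y0; field; rewrite U0 V0 X0 Y0. Qed.

(** Multiplicativity of the 2 by 2 determinant. *)
Lemma det2M (a b c d a' b' c' d' : F) :
  (a * a' + b * c') * (c * b' + d * d') - (a * b' + b * d') * (c * a' + d * c')
  = (a * d - b * c) * (a' * d' - b' * c').
Proof. by ring. Qed.

End DeterminantIdentities.

(** * Action of Aut M_2 on the Delta-primitive elements *)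

Section RankTwoTransitive.
Implicit Types (w u v g h : word 2) (s : 'I_2 -> word 2).

Let x1 : word 2 := gen (@ord0 1).
Let x2 : word 2 := gen (@ord_max 1).

Lemma sum_ord2 (F : 'I_2 -> QA 2) : \sum_i F i = F ord0 + F ord_max.
Proof.
rewrite big_ord_recl big_ord1; congr (_ + F _).
exact: val_inj.
Qed.

Lemma wordA_gen (i : 'I_2) : wordA (gen i) = xA i.
Proof. by rewrite wordA_cons wordA_nil mulr1. Qed.

(* Eliminating [U - 1] and [V - 1] by the fundamental formula leaves the
   Jacobian determinant. *)
Lemma fox_comm_jacobian (i : 'I_2) u v :
  fox i (comm u v) =
    (wordA u)^-1 * (wordA v)^-1 * (wordA x1 * wordA x2) *
    (fox ord0 u * fox ord_max v - fox ord_max u * fox ord0 v) *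
    fox i (comm x1 x2).
Proof.
rewrite !fox_comm !fox_gen !wordA_gen.
have := fox_fundamental u; have := fox_fundamental v; rewrite !sum_ord2 => eV eU.
have X0 := xA_neq0 (@ord0 1); have X1 := xA_neq0 (@ord_max 1).
have -> : wordA u - 1 = fox ord0 u * (xA ord0 - 1) + fox ord_max u * (xA ord_max - 1).
  by rewrite eU.
have -> : 1 - wordA v =
    - (fox ord0 v * (xA ord0 - 1) + fox ord_max v * (xA ord_max - 1)).
  by rewrite eV opprB.
have [->|->] : i = ord0 \/ i = ord_max.
  by case: i => [[|[|//]] hi]; [left | right]; apply: val_inj.
  rewrite eqxx (_ : (ord_max == ord0 :> 'I_2) = false) //.
  exact: (jacobian_identity0 _ _ _ _ _ _ X0 X1).
rewrite eqxx (_ : (ord0 == ord_max :> 'I_2) = false) //.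
exact: (jacobian_identity1 _ _ _ _ _ _ X0 X1).
Qed.

(** By the chain rule, the coefficient matrix of [fox_subst] for the inverse [t], times the Jacobian
    of [s], is the identity; its determinant is [y]. *)
Lemma aut_jacobian_unit s : is_aut s ->
  exists2 y, inZA y &
    (fox ord0 (s ord0) * fox ord_max (s ord_max) -
     fox ord_max (s ord0) * fox ord0 (s ord_max)) * y = 1.
Proof.
move=> [t ts]; have [Y0 Y0Z e0] := fox_subst s (t ord0).
have [Y1 Y1Z e1] := fox_subst s (t ord_max).
exists (Y0 ord0 * Y1 ord_max - Y0 ord_max * Y1 ord0).
  by apply: inZAD; [|apply: inZAN]; apply: inZAM.
have h i j : fox i (subst s (t j)) = (j == i)%:R.
  by rewrite (fox_meq i (ts j).1) fox_gen.
have E00 := h ord0 ord0; rewrite e0 sum_ord2 in E00.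
have E10 := h ord_max ord0; rewrite e0 sum_ord2 in E10.
have E01 := h ord0 ord_max; rewrite e1 sum_ord2 in E01.
have E11 := h ord_max ord_max; rewrite e1 sum_ord2 in E11.
rewrite mulrC -(det2M _ _ _ _ _ _ _ _) E00 E10 E01 E11 /=.
by rewrite mulr1 mulr0 subr0.
Qed.

Lemma delta_primitive_comm : delta_primitive (comm x1 x2).
Proof.
split=> [i|j].
  by apply/inDelta_evalA; rewrite -(expsum_comm i x1 x2); exact: evalA_fox.
have hf i : (wordA x1 * wordA x2) * fox i (comm x1 x2) =
    (1 - xA ord_max) * (ord0 == i)%:R + (xA ord0 - 1) * (ord_max == i)%:R.
  rewrite fox_comm !fox_gen !wordA_gen; set z := _ + _.
  by rewrite -invfM mulrA divff ?mul1r // mulf_neq0 ?xA_neq0.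
have cZ : inZA (wordA x1 * wordA x2) by apply: inZAM; apply: inZA_wordA.
have [->|->] : j = ord0 \/ j = ord_max.
    by case: j => [[|[|//]] hj]; [left | right]; apply: val_inj.
  (* After multiplication by [x_1 x_2], the derivatives are [1 - x_2] and [x_1 - 1]. *)
  exists (fun i => if i == ord0 then 0 else wordA x1 * wordA x2); split=> [i|].
    by case: ifP => // _; exact: inZA0.
  by rewrite sum_ord2 /= mul0r add0r hf /=; ring.
exists (fun i => if i == ord0 then - (wordA x1 * wordA x2) else 0); split=> [i|].
  by case: ifP => // _; [exact: inZAN | exact: inZA0].
by rewrite sum_ord2 /= mul0r addr0 mulNr hf /=; ring.
Qed.

Lemma delta_primitive_subst_comm s :
  is_aut s -> delta_primitive (subst s (comm x1 x2)).
Proof.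
move=> /aut_jacobian_unit[y yZ jy].
rewrite subst_comm !subst_gen.
pose a := wordA (winv (s ord0)) * wordA (winv (s ord_max)) * (wordA x1 * wordA x2).
pose a' := wordA (s ord0) * wordA (s ord_max) * (wordA (winv x1) * wordA (winv x2)).
have aZ : inZA a by rewrite /a -!wordA_cat; exact: inZA_wordA.
have a'Z : inZA a' by rewrite /a' -!wordA_cat; exact: inZA_wordA.
have aa' : a * a' = 1.
  by rewrite /a /a' !wordA_winv unit_identity ?wordA_neq0.
set J := (X in X * y = 1) in jy.
apply: (@delta_primitive_scale _ (a * J) (a' * y) (comm x1 x2)).
- apply: inZAM => //; apply: inZAD; [|apply: inZAN];
    by apply: inZAM; apply: inZA_fox.
- exact: inZAM.
- by rewrite mulrACA aa' jy mulr1.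
- by move=> i; rewrite fox_comm_jacobian /a !wordA_winv.
exact: delta_primitive_comm.
Qed.

Lemma delta_primitive_meq h h' : meq h h' -> delta_primitive h -> delta_primitive h'.
Proof.
move=> e; apply: (@delta_primitive_scale _ 1 1); try exact: inZA1.
  by rewrite mulr1.
by move=> i; rewrite mul1r (fox_meq i e).
Qed.

Lemma delta_primitive_conj h g :
  wordA h = 1 -> delta_primitive h -> delta_primitive (conj h g).
Proof.
move=> h1; apply: (@delta_primitive_scale _ (wordA (winv g)) (wordA g)).
- exact: inZA_wordA.
- exact: inZA_wordA.
- by rewrite wordA_winv mulVf ?wordA_neq0.
by move=> i; rewrite fox_conj // wordA_winv.
Qed.

Lemma delta_primitive_winv h :
  wordA h = 1 -> delta_primitive h -> delta_primitive (winv h).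
Proof.
have N1 : @inZA 2 (-1) by apply: inZAN; exact: inZA1.
move=> h1; apply: (@delta_primitive_scale _ (-1) (-1)) => //.
  by rewrite mulrNN mulr1.
by move=> i; rewrite fox_winv h1 invr1.
Qed.

(** [h] is a conjugate of [comm x1 x2] or of its inverse, so only the image of [comm x1 x2] itself
    needs the Jacobian. *)
Lemma delta_primitive_subst s h :
  is_aut s -> delta_primitive h -> delta_primitive (subst s h).
Proof.
move=> sa /delta_primitive_conj_gen[[g b] /(subst_meq s) e].
apply: (delta_primitive_meq (meq_sym e)).
have c1 : wordA (subst s (comm x1 x2)) = 1 by rewrite subst_comm wordA_comm.
rewrite /conj_gen subst_conj [_.2]/= [_.1]/=; apply: delta_primitive_conj.
  by case: b {e}; rewrite // subst_comm wordA_comm.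
case: b {e}; last exact: delta_primitive_subst_comm.
rewrite -winv_comm subst_winv; apply: delta_primitive_winv => //.
exact: delta_primitive_subst_comm.
Qed.

(** With [p] the identity or the transposition, [[x_1,x_2]] is sent to any conjugate of itself or of
    its inverse. *)
Definition conj_aut (p : 'I_2 -> 'I_2) g (i : 'I_2) : word 2 := conj (gen (p i)) g.

Lemma subst_conj_aut p g w :
  meq (subst (conj_aut p g) w) (conj (subst (gen \o p) w) g).
Proof.
elim: w => [|l w ih]; first by free_reduce.
rewrite !subst_cons conj_cat ih; apply: meq_cat => //.
by rewrite /subst_letter /conj_aut; case: l.2; rewrite // winv_conj.
Qed.

Lemma subst_rename_involutive p w :
  involutive p -> subst (gen \o p) (subst (gen \o p) w) = w.
Proof.
move=> pp; elim: w => [|l w ih] //; rewrite subst_cons subst_cat ih.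
by case: l => i []; rewrite /subst_letter /= /subst_letter /= pp.
Qed.

Lemma conj_aut_is_aut p g : involutive p -> is_aut (conj_aut p g).
Proof.
(* Renaming again turns [g] into its renamed form, so the inverse conjugates by the inverse of
   that. *)
move=> pp; exists (conj_aut p (winv (subst (gen \o p) g))) => i.
have hp j : subst (gen \o p) (gen (p j)) = gen j by rewrite subst_gen /= pp.
split; rewrite subst_conj_aut /conj_aut subst_conj hp.
  by rewrite subst_winv subst_rename_involutive // conj_conj meq_winvl conj_nil.
by rewrite conj_conj meq_winvr conj_nil.
Qed.

End RankTwoTransitive.

Theorem theorem1p4 :
  (* (i) Aut M_2 acts transitively on the Delta-primitive elements of M_2 *)
  (let x1 : word 2 := gen (@ord0 1) in
   let x2 : word 2 := gen (@ord_max 1) in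
   delta_primitive (comm x1 x2) /\
   (forall (s : 'I_2 -> word 2) (h : word 2),
       is_aut s -> delta_primitive h -> delta_primitive (subst s h)) /\
   (forall h : word 2, delta_primitive h ->
       exists s : 'I_2 -> word 2, is_aut s /\ meq h (subst s (comm x1 x2))) /\
   (forall h : word 2, delta_primitive h ->
       exists g : word 2,
         meq h (conj (comm x1 x2) g) \/ meq h (conj (comm x2 x1) g))) /\
  (* (ii) for odd n >= 2, M_n has no Delta-primitive elements *)
  (forall n : nat, (2 <= n)%N -> odd n ->
     forall h : word n, ~ delta_primitive h).
Proof.
split; last by move=> n _ n_odd h; apply: odd_not_delta_primitive.
move=> x1 x2; split; first exact: delta_primitive_comm.
split; first exact: delta_primitive_subst.
split=> h /delta_primitive_conj_gen[[g b] hg]; last first.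
  by exists g; case: b hg; [right | left].
(* The transposition of the generators accounts for the negative sign. *)
pose p : 'I_2 -> 'I_2 := if b then @rev_ord 2 else id.
exists (conj_aut p g); split.
  by apply: conj_aut_is_aut; rewrite /p; case: (b) => // i; exact: rev_ordK.
rewrite hg subst_conj_aut subst_comm !subst_gen /p; case: (b).
  have e0 : rev_ord ord0 = ord_max :> 'I_2 by apply: val_inj.
  have e1 : rev_ord ord_max = ord0 :> 'I_2 by apply: val_inj.
  rewrite [X in comm X _](_ : _ = x2) ?[X in comm _ X](_ : _ = x1).
  - exact: meq_refl.
  - by rewrite /= e1.
  - by rewrite /= e0.
exact: meq_refl.
Qed.
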